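(* Let $H$ be a quasi-Hopf algebra and $A$ a left $H$-module algebra. Denote by $i:A\to A\# H$, $i(a)=a\# 1$ and $j:H\to A\# H$, $j(h)=1\# h$. Let $B$ be an associative algebra, $\gamma:H\to B$ an algebra map and $v:A\to B$ a linear map satisfying, for $a,a'\in A$, $h\in H$: $$\gamma(h)v(a)=v(h_1\cdot a)\gamma(h_2),\qquad v(aa')=v(X^1\cdot a)v(X^2\cdot a')\gamma(X^3),\qquad v(1_A)=1_B.$$ Then there exists a unique algebra map $w:A\# H\to B$ such that $w\circ i=v$ and $w\circ j=\gamma$. Moreover, $w$ is given by the formula $w(a\# h)=v(a)\gamma(h)$, for $a\in A$, $h\in H$.
   Context: Throughout, $k$ is a field, all algebras and linear spaces are over $k$, $\otimes=\otimes_k$. A quasi-bialgebra $(H,\Delta,\varepsilon,\Phi)$ is a unital associative algebra $H$ with algebra maps $\Delta:H\to H\otimes H$, $\varepsilon:H\to k$ and an invertible $\Phi\in H^{\otimes 3}$ such that for all $h\in H$: $(id\otimes\Delta)(\Delta(h))=\Phi(\Delta\otimes id)(\Delta(h))\Phi^{-1}$; $(id\otimes\varepsilon)(\Delta(h))=h=(\varepsilon\otimes id)(\Delta(h))$; $(1\otimes\Phi)(id\otimes\Delta\otimes id)(\Phi)(\Phi\otimes 1)=(id\otimes id\otimes\Delta)(\Phi)(\Delta\otimes id\otimes id)(\Phi)$; $(\varepsilon\otimes id\otimes id)(\Phi)=(id\otimes\varepsilon\otimes id)(\Phi)=(id\otimes id\otimes\varepsilon)(\Phi)=1\otimes 1$.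 Notation (summation understood): $\Delta(h)=h_1\otimes h_2$, $\Phi=X^1\otimes X^2\otimes X^3$, $\Phi^{-1}=x^1\otimes x^2\otimes x^3$. A quasi-Hopf algebra is a quasi-bialgebra $H$ with an algebra anti-automorphism $S$ and $\alpha,\beta\in H$ such that $S(h_1)\alpha h_2=\varepsilon(h)\alpha$, $h_1\beta S(h_2)=\varepsilon(h)\beta$ for all $h$, $X^1\beta S(X^2)\alpha X^3=1$, $S(x^1)\alpha x^2\beta S(x^3)=1$; normalised (as one may) so that $\varepsilon(\alpha)=\varepsilon(\beta)=1$ and $\varepsilon\circ S=\varepsilon$. A left $H$-module algebra is a left $H$-module $A$ with a multiplication and (usual) unit $1_A$ such that $(aa')a''=(X^1\cdot a)[(X^2\cdot a')(X^3\cdot a'')]$, $h\cdot(aa')=(h_1\cdot a)(h_2\cdot a')$, $h\cdot 1_A=\varepsilon(h)1_A$. The smash product $A\# H$ is $A\otimes H$ (elements written $a\# h$) with the associative multiplication $(a\# h)(a'\# h')=(x^1\cdot a)(x^2h_1\cdot a')\# x^3h_2h'$ and unit $1_A\# 1$. *)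

(* Defs.v *)
From HB Require Import structures.
From mathcomp Require Import all_boot all_algebra.
From mathcomp Require Import boolp.

Set Implicit Arguments.
Unset Strict Implicit.
Unset Printing Implicit Defensive.

Import GRing.Theory.
Local Open Scope ring_scope.
Local Open Scope quotient_scope.

Reserved Notation "x ⊗ y" (at level 45, right associativity).
Reserved Notation "\sw_ ( a , b <- x ) F"
  (at level 46, F at level 46, a name, b name, x at level 60,
   format "'[' \sw_ ( a ,  b  <-  x ) '/  '  F ']'").
Reserved Notation "\sw_ ( a , b , c <- x ) F"
  (at level 46, F at level 46, a name, b name, c name, x at level 60,
   format "'[' \sw_ ( a ,  b ,  c  <-  x ) '/  '  F ']'").

Declare Scope assoc_scope.
Delimit Scope assoc_scope with A.
Reserved Notation "f ⊠ g" (at level 45, right associativity).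

Section TensorType.
Variables (K : fieldType) (V W : lmodType K).

(* V ⊗ W is the set of finite formal sums of pairs (v, w), written as
   sequences, modulo the congruence generated by the bilinearity relations.
   Scalars are absorbed in the left factor. *)
Inductive tcong : seq (V * W) -> seq (V * W) -> Prop :=
| Tcong_refl s : tcong s s
| Tcong_sym s t : tcong s t -> tcong t s
| Tcong_trans t s u : tcong s t -> tcong t u -> tcong s u
| Tcong_cat s s' t t' : tcong s s' -> tcong t t' -> tcong (s ++ t) (s' ++ t')
| Tcong_comm s t : tcong (s ++ t) (t ++ s)
| Tcong_zero w : tcong [:: (0, w)] [::]
| Tcong_addl v v' w : tcong [:: (v + v', w)] [:: (v, w); (v', w)]
| Tcong_addr v w w' : tcong [:: (v, w + w')] [:: (v, w); (v, w')]
| Tcong_scale (c : K) v w : tcong [:: (c *: v, w)] [:: (v, c *: w)].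

Definition tcongb (s t : seq (V * W)) : bool := `[< tcong s t >].

Lemma tcongb_refl : reflexive tcongb.
Proof. by move=> s; apply/asboolP/Tcong_refl. Qed.
Lemma tcongb_sym : symmetric tcongb.
Proof. by move=> s t; apply/asboolP/asboolP => /Tcong_sym. Qed.
Lemma tcongb_trans : transitive tcongb.
Proof.
by move=> t s u /asboolP st /asboolP tu; apply/asboolP; apply: Tcong_trans st tu.
Qed.

Canonical tcong_equiv := EquivRel tcongb tcongb_refl tcongb_sym tcongb_trans.

Definition tensor := {eq_quot tcongb}.
HB.instance Definition _ := Choice.on tensor.
HB.instance Definition _ := Quotient.on tensor.
HB.instance Definition _ : EqQuotient _ tcongb tensor := EqQuotient.on tensor.

Definition tens (v : V) (w : W) : tensor := \pi_tensor [:: (v, w)].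

Lemma tens_piP (s t : seq (V * W)) : tcong s t <-> \pi_tensor s = \pi_tensor t.
Proof.
split=> [st|/eqmodP/asboolP//].
by apply/eqmodP/asboolP.
Qed.

Lemma tensW (P : tensor -> Prop) : (forall s, P (\pi_tensor s)) -> forall x, P x.
Proof. by move=> Ppi x; rewrite -[x]reprK. Qed.

Lemma tcong_repr (s : seq (V * W)) : tcong (repr (\pi_tensor s)) s.
Proof. by apply/tens_piP; rewrite reprK. Qed.

Lemma Tcong_zeror v : tcong [:: (v, 0)] [::].
Proof.
have := Tcong_sym (Tcong_scale 0 v 0); rewrite scaler0 scale0r => /Tcong_trans.
by apply; apply: Tcong_zero.
Qed.

Definition tzero : tensor := \pi_tensor [::].
Definition tadd (x y : tensor) : tensor := \pi_tensor (repr x ++ repr y).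
Definition tscale (c : K) (x : tensor) : tensor :=
  \pi_tensor [seq (c *: p.1, p.2) | p <- repr x].
Definition topp (x : tensor) : tensor := tscale (-1) x.

Lemma tadd_pi s t : tadd (\pi_tensor s) (\pi_tensor t) = \pi_tensor (s ++ t).
Proof. by apply/tens_piP/Tcong_cat; apply: tcong_repr. Qed.

Lemma tcong_map c s t : tcong s t ->
  tcong [seq (c *: p.1, p.2) | p <- s] [seq (c *: p.1, p.2) | p <- t].
Proof.
elim=> {s t} //=.
- by move=> s; apply: Tcong_refl.
- by move=> s t _; apply: Tcong_sym.
- by move=> s t u _ st _; apply: Tcong_trans.
- by move=> s s' t t' _ ss _ tt; rewrite !map_cat; apply: Tcong_cat.
- by move=> s t; rewrite !map_cat; apply: Tcong_comm.
- by move=> w; rewrite scaler0; apply: Tcong_zero.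
- by move=> v v' w; rewrite scalerDr; apply: Tcong_addl.
- by move=> v w w'; apply: Tcong_addr.
- move=> d v w; rewrite scalerA mulrC -scalerA; exact: Tcong_scale.
Qed.

Lemma tscale_pi c s :
  tscale c (\pi_tensor s) = \pi_tensor [seq (c *: p.1, p.2) | p <- s].
Proof. by apply/tens_piP/tcong_map/tcong_repr. Qed.

Lemma taddA : associative tadd.
Proof.
move=> x y z; elim/tensW: x => s; elim/tensW: y => t; elim/tensW: z => u.
by rewrite !tadd_pi catA.
Qed.
Lemma taddC : commutative tadd.
Proof.
move=> x y; elim/tensW: x => s; elim/tensW: y => t; rewrite !tadd_pi.
by apply/tens_piP/Tcong_comm.
Qed.
Lemma tadd0 : left_id tzero tadd.
Proof. by move=> x; elim/tensW: x => s; rewrite tadd_pi. Qed.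

Lemma tpi_cons p s : \pi_tensor (p :: s) = tadd (tens p.1 p.2) (\pi_tensor s).
Proof. by case: p => v w; rewrite tadd_pi. Qed.

Lemma tscaleDl (x : tensor) : {morph tscale^~ x : a b / a + b >-> tadd a b}.
Proof.
move=> a b; elim/tensW: x; elim=> [|p s IH]; rewrite !tscale_pi /=.
  by rewrite tadd_pi.
move: IH; rewrite !tscale_pi !tpi_cons => ->; set A := \pi _; set B := \pi _.
have -> : tens ((a + b) *: p.1) p.2 =
          tadd (tens (a *: p.1) p.2) (tens (b *: p.1) p.2).
  by rewrite scalerDl tadd_pi; apply/tens_piP/Tcong_addl.
rewrite -!taddA; congr tadd.
by rewrite [RHS]taddC -taddA; congr tadd; rewrite taddC.
Qed.

Lemma tscale0 (x : tensor) : tscale 0 x = tzero.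
Proof.
elim/tensW: x; elim=> [|p s IH]; rewrite tscale_pi //=.
rewrite tpi_cons -tscale_pi IH taddC tadd0 scale0r.
by apply/tens_piP/Tcong_zero.
Qed.

Lemma tscale1 : left_id 1 tscale.
Proof.
move=> x; elim/tensW: x => s; rewrite tscale_pi; congr \pi_tensor.
by rewrite -[RHS]map_id; apply: eq_map => -[v w]; rewrite scale1r.
Qed.

Lemma taddN : left_inverse tzero topp tadd.
Proof.
by move=> x; rewrite -{2}[x]tscale1 /topp -tscaleDl addNr tscale0.
Qed.

HB.instance Definition _ := GRing.isZmodule.Build tensor taddA taddC tadd0 taddN.

Lemma tscaleA a b (x : tensor) : tscale a (tscale b x) = tscale (a * b) x.
Proof.
elim/tensW: x => s; rewrite !tscale_pi -map_comp; congr \pi_tensor.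
by apply: eq_map => p; rewrite /= scalerA.
Qed.

Lemma tscaleDr : right_distributive tscale +%R.
Proof.
move=> c x y; elim/tensW: x => s; elim/tensW: y => t.
by rewrite [_ + _]tadd_pi !tscale_pi [_ + _]tadd_pi map_cat.
Qed.

HB.instance Definition _ :=
  GRing.Zmodule_isLmodule.Build K tensor tscaleA tscale1 tscaleDr tscaleDl.

Lemma tens_pi_cons p s : \pi_tensor (p :: s) = tens p.1 p.2 + \pi_tensor s.
Proof. exact: tpi_cons. Qed.

Lemma tensDl v v' w : tens (v + v') w = tens v w + tens v' w.
Proof.
rewrite [RHS]tadd_pi; by apply/tens_piP/Tcong_addl.
Qed.

Lemma tensDr v w w' : tens v (w + w') = tens v w + tens v w'.
Proof.
rewrite [RHS]tadd_pi; by apply/tens_piP/Tcong_addr.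
Qed.

Lemma tensZl c v w : tens (c *: v) w = c *: tens v w.
Proof. by rewrite [RHS]tscale_pi. Qed.

Lemma tensZr c v w : tens v (c *: w) = c *: tens v w.
Proof. by rewrite -tensZl; apply/esym/tens_piP/Tcong_scale. Qed.

Lemma tens_ind (P : tensor -> Prop) : P 0 ->
  (forall v w x, P x -> P (tens v w + x)) -> forall x, P x.
Proof.
move=> P0 PD x; elim/tensW: x; elim=> [|[v w] s IH]; first exact: P0.
by rewrite tens_pi_cons; apply: PD.
Qed.

End TensorType.

Arguments tensor {K} (V W)%_type_scope.
Arguments tens {K V W} v w.
Arguments tens : clear scopes.
Notation "V ⊗ W" := (tensor V W) : type_scope.
Notation "v ⊗ w" := (tens v w) : ring_scope.

Definition bilinear_map (K : fieldType) (V W U : lmodType K) (f : V -> W -> U) :=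
  (forall w, linear (f^~ w)) /\ (forall v, linear (f v)).

Section LinearFacts.
Variables (K : fieldType) (V W : lmodType K) (f : V -> W).
Hypothesis fL : linear f.

Lemma lin0 : f 0 = 0.
Proof. by have := fL (-1) 0 0; rewrite scaler0 addr0 scaleN1r addNr. Qed.
Lemma linD x y : f (x + y) = f x + f y.
Proof. by have := fL 1 x y; rewrite !scale1r. Qed.
Lemma linZ c x : f (c *: x) = c *: f x.
Proof. by have := fL c x 0; rewrite lin0 !addr0. Qed.

End LinearFacts.

Section Tlift.
Variables (K : fieldType) (V W U : lmodType K).
Implicit Types (f g : V -> W -> U) (x y : V ⊗ W).

(* The sum of f v w over the terms of the representative of x chosen by repr;
   for bilinear f it does not depend on the representative (tlift_pi, tliftE),
   so \sw_(a, b <- x) F is the Sweedler sum of F over x = a ⊗ b. *)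
Definition tlift x f : U := \sum_(p <- repr x) f p.1 p.2.

Lemma tlift_pi f : bilinear_map f ->
  forall s, tlift (\pi_(V ⊗ W) s) f = \sum_(p <- s) f p.1 p.2.
Proof.
case=> fl fr s; rewrite /tlift; move: (tcong_repr s); move: (repr _) => t.
elim=> {s t} //=.
- by move=> s t u _ -> _ ->.
- by move=> s s' t t' _ st _ st'; rewrite !big_cat st st'.
- by move=> s t; rewrite !big_cat; apply: addrC.
- by move=> w; rewrite big_seq1 big_nil; apply: (lin0 (fl w)).
- move=> v v' w; rewrite big_seq1 big_cons big_seq1 /=; exact: (linD (fl w)).
- move=> v w w'; rewrite big_seq1 big_cons big_seq1 /=; exact: (linD (fr v)).
- by move=> c v w; rewrite !big_seq1 /= (linZ (fl w)) (linZ (fr v)).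
Qed.

Lemma tliftE f v w : bilinear_map f -> tlift (v ⊗ w) f = f v w.
Proof. by move=> fB; rewrite tlift_pi // big_seq1. Qed.

Lemma tlift_linear f : bilinear_map f -> linear (tlift^~ f).
Proof.
move=> fB c x y; elim/tensW: x => s; elim/tensW: y => t.
have -> : c *: \pi_(V ⊗ W) s + \pi_(V ⊗ W) t =
    \pi_(V ⊗ W) ([seq (c *: p.1, p.2) | p <- s] ++ t).
  by rewrite [c *: _]tscale_pi [_ + _]tadd_pi.
rewrite !tlift_pi // big_cat big_map scaler_sumr /=; congr (_ + _).
have [fl _] := fB; apply: eq_bigr => -[v w] _ /=; exact: (linZ (fl w)).
Qed.

Lemma eq_tlift f g : (forall v w, f v w = g v w) -> tlift^~ f =1 tlift^~ g.
Proof. by move=> fg x; apply: eq_bigr => p _; apply: fg. Qed.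

End Tlift.

Arguments tlift : clear scopes.
Notation "\sw_ ( a , b <- x ) F" := (tlift x (fun a b => F)) : ring_scope.
Notation "\sw_ ( a , b , c <- x ) F" :=
  (tlift x (fun a y => tlift y (fun b c => F))) : ring_scope.

Section LinRules.
Variables (K : fieldType).
Implicit Types (T V W U : lmodType K).

Lemma lin_id T : linear (fun x : T => x). Proof. by []. Qed.

Lemma lin_comp T V U (g : V -> U) (f : T -> V) :
  linear g -> linear f -> linear (fun x => g (f x)).
Proof. by move=> gL fL c x y; rewrite /= fL gL. Qed.

Lemma lin_tensl T V W (f : T -> V) (w : W) :
  linear f -> linear (fun x => f x ⊗ w).
Proof. by move=> fL c x y; rewrite fL tensDl tensZl. Qed.

Lemma lin_tensr T V W (f : T -> W) (v : V) :
  linear f -> linear (fun x => v ⊗ f x).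
Proof. by move=> fL c x y; rewrite fL tensDr tensZr. Qed.

Lemma lin_tlift_t T V W U (f : V -> W -> U) (g : T -> V ⊗ W) :
  bilinear_map f -> linear g -> linear (fun x => tlift (g x) f).
Proof. by move=> fB gL; apply: (lin_comp (tlift_linear fB) gL). Qed.

Lemma lin_tlift_f T V W U (f : T -> V -> W -> U) (x : V ⊗ W) :
  (forall v w, linear (fun t => f t v w)) -> linear (fun t => tlift x (f t)).
Proof.
move=> fL c t u; rewrite /tlift scaler_sumr -big_split /=.
by apply: eq_bigr => p _; rewrite fL.
Qed.

Lemma lin_scale T V (c : K) (f : T -> V) :
  linear f -> linear (fun x => c *: f x).
Proof. by move=> fL d x y; rewrite fL scalerDr !scalerA mulrC. Qed.

Lemma lin_scalel T V (v : V) (f : T -> K) :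
  scalar f -> linear (fun x => f x *: v).
Proof. by move=> fL d x y; rewrite fL scalerDl scalerA. Qed.

Lemma lin_eq V W U (f g : V ⊗ W -> U) : linear f -> linear g ->
  (forall v w, f (v ⊗ w) = g (v ⊗ w)) -> f =1 g.
Proof.
move=> fL gL fg; elim/tens_ind=> [|v w x IH].
  by rewrite (lin0 fL) (lin0 gL).
by rewrite (linD fL) (linD gL) fg IH.
Qed.

End LinRules.

(* Unital associative algebras over K. Contrary to algType, 1 = 0 is allowed:
   a module algebra A may be zero, and then so is its smash product. *)
HB.mixin Record Lmodule_isAssocAlgebra (K : fieldType) A of GRing.Lmodule K A := {
  aone : A;
  amul : A -> A -> A;
  amulA : associative amul;
  amul1 : left_id aone amul;
  amulr1 : right_id aone amul;
  amul_bilinear : bilinear_map amul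
}.

#[short(type="assocAlgType")]
HB.structure Definition AssocAlgebra (K : fieldType) :=
  {A of GRing.Lmodule K A & Lmodule_isAssocAlgebra K A}.

Bind Scope assoc_scope with AssocAlgebra.sort.
Notation "1" := (@aone _ _) : assoc_scope.
Notation "x * y" := (amul x y) : assoc_scope.
Local Open Scope assoc_scope.

Definition alg_map (K : fieldType) (A B : assocAlgType K) (f : A -> B) : Prop :=
  [/\ linear f, f 1 = 1 & forall x y, f (x * y) = f x * f y].

Section AssocAlgebraTheory.
Variables (K : fieldType).
Implicit Types (T : lmodType K) (A : assocAlgType K).

Lemma lin_mull T A (a : A) (f : T -> A) : linear f -> linear (fun x => f x * a).
Proof. have [mL _] := @amul_bilinear K A; apply: lin_comp (mL a). Qed.

Lemma lin_mulr T A (a : A) (f : T -> A) : linear f -> linear (fun x => a * f x).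
Proof. have [_ mR] := @amul_bilinear K A; apply: lin_comp (mR a). Qed.

End AssocAlgebraTheory.

Ltac lin := repeat first
  [ assumption
  | match goal with |- bilinear_map _ => split; move=> ?; cbv beta end
  | match goal with |- forall _, _ => intro; cbv beta end
  | match goal with |- linear (fun x => x) => apply: lin_id end
  | match goal with |- @GRing.linear_for _ _ _ _ ?f =>
      lazymatch f with (fun _ => _) => fail | _ => change f with (fun x => f x) end
    end
  | match goal with |- linear (fun x => tens _ _) =>
       first [apply: lin_tensl | apply: lin_tensr] end
  | apply: lin_tlift_t | apply: lin_tlift_f | apply: lin_mull | apply: lin_mulr
  | apply: lin_scalel | apply: lin_scale].

Section TensorAlgebra.
Variables (K : fieldType) (H G : assocAlgType K).
Implicit Types x y z : H ⊗ G.

Definition tone : H ⊗ G := (1 : H) ⊗ (1 : G).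
Definition tmul x y : H ⊗ G :=
  \sw_(a, b <- x) \sw_(c, d <- y) (a * c) ⊗ (b * d).


Lemma tmul_bilinear : bilinear_map tmul.
Proof. by rewrite /tmul; lin. Qed.

Lemma tmulE a b c d : tmul (a ⊗ b) (c ⊗ d) = (a * c) ⊗ (b * d).
Proof. by rewrite /tmul !tliftE //; lin. Qed.

Lemma tmulA : associative tmul.
Proof.
have [tL tR] := tmul_bilinear.
move=> x y z; move: x; apply: lin_eq.
- exact: tL.
- exact: lin_comp (tL z) (tL y).
move=> a b; move: y; apply: lin_eq.
- exact: lin_comp (tR _) (tL z).
- exact: lin_comp (tL z) (tR _).
move=> c d; move: z; apply: lin_eq.
- exact: lin_comp (tR _) (tR _).
- exact: tR.
by move=> e f; rewrite !tmulE !amulA.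
Qed.

Lemma tmul1 : left_id tone tmul.
Proof.
have [tL tR] := tmul_bilinear.
apply: lin_eq; [exact: tR | exact: lin_id | move=> a b].
by rewrite tmulE !amul1.
Qed.

Lemma tmulr1 : right_id tone tmul.
Proof.
have [tL tR] := tmul_bilinear.
apply: lin_eq; [exact: tL | exact: lin_id | move=> a b].
by rewrite tmulE !amulr1.
Qed.

HB.instance Definition _ := Lmodule_isAssocAlgebra.Build K (H ⊗ G)%type
  tmulA tmul1 tmulr1 tmul_bilinear.

Lemma tensM (a c : H) (b d : G) : (a ⊗ b) * (c ⊗ d) = (a * c) ⊗ (b * d).
Proof. exact: tmulE. Qed.

Lemma tens1 : (1 : H ⊗ G) = (1 : H) ⊗ (1 : G). Proof. by []. Qed.

End TensorAlgebra.

Section TensorMaps.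
Variables (K : fieldType).

Definition tmap (V W V' W' : lmodType K) (f : V -> V') (g : W -> W')
    (x : V ⊗ W) : V' ⊗ W' := \sw_(v, w <- x) f v ⊗ g w.

Definition tassoc (U V W : lmodType K) (x : (U ⊗ V) ⊗ W) : U ⊗ (V ⊗ W) :=
  \sw_(y, w <- x) \sw_(u, v <- y) u ⊗ (v ⊗ w).

Lemma tlift_comp (V W U T : lmodType K) (g : U -> T) (f : V -> W -> U) x :
  linear g -> g (tlift x f) = tlift x (fun a b => g (f a b)).
Proof.
move=> gL; rewrite /tlift; elim: (repr x) => [|p s IH].
  by rewrite !big_nil (lin0 gL).
by rewrite !big_cons (linD gL) IH.
Qed.

Lemma tmapE (V W V' W' : lmodType K) (f : V -> V') (g : W -> W') v w :
  linear f -> linear g -> tmap f g (v ⊗ w) = f v ⊗ g w.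
Proof.
move=> fL gL; rewrite /tmap tliftE //; split=> ?; cbv beta.
  by apply: lin_tensl.
exact: lin_tensr.
Qed.

Lemma tmap_linear (V W V' W' : lmodType K) (f : V -> V') (g : W -> W') :
  linear f -> linear g -> linear (tmap f g).
Proof.
move=> fL gL; rewrite /tmap; apply: (lin_tlift_t _ (@lin_id _ _)); split=> ?; cbv beta.
  by apply: lin_tensl.
exact: lin_tensr.
Qed.

Lemma tassocE (U V W : lmodType K) (u : U) (v : V) (w : W) :
  tassoc ((u ⊗ v) ⊗ w) = u ⊗ (v ⊗ w).
Proof. by rewrite /tassoc !tliftE //; lin. Qed.

Lemma tassoc_linear (U V W : lmodType K) : linear (@tassoc U V W).
Proof. by rewrite /tassoc; lin. Qed.

Lemma id_alg_map (A : assocAlgType K) : alg_map (@id A).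
Proof. by []. Qed.

Lemma comp_alg_map (A B C : assocAlgType K) (g : B -> C) (f : A -> B) :
  alg_map g -> alg_map f -> alg_map (fun x => g (f x)).
Proof.
case=> gL g1 gM [fL f1 fM]; split; first exact: lin_comp gL fL.
  by rewrite f1.
by move=> x y; rewrite fM gM.
Qed.

Lemma tens_alg_map (V W B : assocAlgType K) (f : V ⊗ W -> B) :
  linear f -> f 1 = 1 ->
  (forall v v' w w', f ((v ⊗ w) * (v' ⊗ w')) = f (v ⊗ w) * f (v' ⊗ w')) ->
  alg_map f.
Proof.
move=> fL f1 fM; split=> // x y; move: x; apply: lin_eq.
- by apply: (lin_comp fL); apply: lin_mull.
- by apply: lin_mull.
move=> v w; move: y; apply: lin_eq.
- by apply: (lin_comp fL); apply: lin_mulr.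
- by apply: lin_mulr.
by move=> v' w'; apply: fM.
Qed.

Lemma tmap_alg_map (V W V' W' : assocAlgType K) (f : V -> V') (g : W -> W') :
  alg_map f -> alg_map g -> alg_map (tmap f g).
Proof.
case=> fL f1 fM [gL g1 gM]; apply: tens_alg_map.
- exact: tmap_linear.
- by rewrite tmapE // f1 g1.
by move=> v v' w w'; rewrite tensM !tmapE // fM gM tensM.
Qed.

Lemma tassoc_alg_map (U V W : assocAlgType K) : alg_map (@tassoc U V W).
Proof.
have aL := @tassoc_linear U V W.
split=> //; first exact: tassocE.
move=> x y; move: x; apply: lin_eq.
- by apply: (lin_comp aL); apply: lin_mull.
- by apply: lin_mull.
move=> x w; move: y; apply: lin_eq.
- by apply: (lin_comp aL); apply: lin_mulr.
- by apply: lin_mulr.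
move=> y w'; rewrite tensM; move: x; apply: lin_eq.
- by apply: (lin_comp aL); apply: lin_tensl; apply: lin_mull.
- by apply: lin_mull; apply: (lin_comp aL); apply: lin_tensl.
move=> u v; move: y; apply: lin_eq.
- by apply: (lin_comp aL); apply: lin_tensl; apply: lin_mulr.
- by apply: lin_mulr; apply: (lin_comp aL); apply: lin_tensl.
by move=> u' v'; rewrite tensM !tassocE !tensM.
Qed.

Lemma tensr_alg_map (U V : assocAlgType K) : alg_map (fun v : V => (1 : U) ⊗ v).
Proof. by split=> // [|x y]; [apply: lin_tensr | rewrite tensM amul1]. Qed.

End TensorMaps.

Notation "f ⊠ g" := (tmap f g) : assoc_scope.

(* H^{⊗3} and H^{⊗4} are bracketed to the right; tassoc is the canonical
   isomorphism (U ⊗ V) ⊗ W -> U ⊗ (V ⊗ W) that is implicit on paper. The two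
   factors H ⊗ K and K ⊗ H are identified with H through scaling.
   qb_Phi' is the inverse of qb_Phi. *)
Record quasiBialgebra (K : fieldType) (H : assocAlgType K) := QuasiBialgebra {
  qb_Delta : H -> H ⊗ H;
  qb_eps : H -> K;
  qb_Phi : H ⊗ (H ⊗ H);
  qb_Phi' : H ⊗ (H ⊗ H);
  qb_Delta_alg : alg_map qb_Delta;
  qb_eps_linear : scalar qb_eps;
  qb_eps1 : qb_eps 1 = 1%R;
  qb_epsM : forall h g, qb_eps (h * g) = (qb_eps h * qb_eps g)%R;
  qb_PhiK : qb_Phi' * qb_Phi = 1;
  qb_PhiVK : qb_Phi * qb_Phi' = 1;
  qb_coassoc : forall h,
    (id ⊠ qb_Delta) (qb_Delta h)
    = qb_Phi * tassoc ((qb_Delta ⊠ id) (qb_Delta h)) * qb_Phi';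
  qb_counitr : forall h, (\sw_(h1, h2 <- qb_Delta h) qb_eps h2 *: h1) = h;
  qb_counitl : forall h, (\sw_(h1, h2 <- qb_Delta h) qb_eps h1 *: h2) = h;
  qb_pentagon :
    ((1 : H) ⊗ qb_Phi)
      * (id ⊠ @tassoc _ H H H) ((id ⊠ (qb_Delta ⊠ id)) qb_Phi)
      * (id ⊠ @tassoc _ H H H) (tassoc (qb_Phi ⊗ (1 : H)))
    = (id ⊠ (id ⊠ qb_Delta)) qb_Phi * tassoc ((qb_Delta ⊠ id) qb_Phi);
  qb_eps_Phi1 : (\sw_(x1, x2, x3 <- qb_Phi) qb_eps x1 *: (x2 ⊗ x3)) = 1;
  qb_eps_Phi2 : (\sw_(x1, x2, x3 <- qb_Phi) qb_eps x2 *: (x1 ⊗ x3)) = 1;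
  qb_eps_Phi3 : (\sw_(x1, x2, x3 <- qb_Phi) qb_eps x3 *: (x1 ⊗ x2)) = 1
}.

Record quasiHopfAlgebra (K : fieldType) (H : assocAlgType K) := QuasiHopfAlgebra {
  qh_bialgebra :> quasiBialgebra H;
  qh_S : H -> H;
  qh_alpha : H;
  qh_beta : H;
  qh_S_linear : linear qh_S;
  qh_S_bij : bijective qh_S;
  qh_S1 : qh_S 1 = 1;
  qh_SM : forall h g, qh_S (h * g) = qh_S g * qh_S h;
  qh_alphaP : forall h,
    (\sw_(h1, h2 <- qb_Delta qh_bialgebra h) qh_S h1 * qh_alpha * h2)
    = qb_eps qh_bialgebra h *: qh_alpha;
  qh_betaP : forall h,
    (\sw_(h1, h2 <- qb_Delta qh_bialgebra h) h1 * qh_beta * qh_S h2)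
    = qb_eps qh_bialgebra h *: qh_beta;
  qh_Phi : (\sw_(x1, x2, x3 <- qb_Phi qh_bialgebra)
      x1 * qh_beta * qh_S x2 * qh_alpha * x3) = 1;
  qh_Phi' : (\sw_(x1, x2, x3 <- qb_Phi' qh_bialgebra)
      qh_S x1 * qh_alpha * x2 * qh_beta * qh_S x3) = 1;
  qh_eps_alpha : qb_eps qh_bialgebra qh_alpha = 1%R;
  qh_eps_beta : qb_eps qh_bialgebra qh_beta = 1%R;
  qh_eps_S : forall h, qb_eps qh_bialgebra (qh_S h) = qb_eps qh_bialgebra h
}.

(* The multiplication of A is unital but not associative: ma_mulA replaces
   associativity. *)
Record moduleAlgebra (K : fieldType) (H : assocAlgType K) (Q : quasiBialgebra H)
    (A : lmodType K) := ModuleAlgebra {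
  ma_act : H -> A -> A;
  ma_one : A;
  ma_mul : A -> A -> A;
  ma_act_bilinear : bilinear_map ma_act;
  ma_act1 : forall a, ma_act 1 a = a;
  ma_actM : forall h g a, ma_act (h * g) a = ma_act h (ma_act g a);
  ma_mul_bilinear : bilinear_map ma_mul;
  ma_mul1 : left_id ma_one ma_mul;
  ma_mulr1 : right_id ma_one ma_mul;
  ma_mulA : forall a a' a'',
    ma_mul (ma_mul a a') a''
    = \sw_(x1, x2, x3 <- qb_Phi Q)
        ma_mul (ma_act x1 a) (ma_mul (ma_act x2 a') (ma_act x3 a''));
  ma_act_mul : forall h a a',
    ma_act h (ma_mul a a')
    = \sw_(h1, h2 <- qb_Delta Q h) ma_mul (ma_act h1 a) (ma_act h2 a');
  ma_act_one : forall h, ma_act h ma_one = qb_eps Q h *: ma_one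
}.

Section Smash.
Variables (K : fieldType) (H : assocAlgType K) (Q : quasiBialgebra H).
Variables (A : lmodType K) (M : moduleAlgebra Q A).

Local Notation "h '·' a" := (ma_act M h a) (at level 38, right associativity).
Local Notation "a '∘' b" := (ma_mul M a b) (at level 39).

Definition smash_one : A ⊗ H := ma_one M ⊗ (1 : H).
Definition smash_mul (p q : A ⊗ H) : A ⊗ H :=
  \sw_(a, h <- p) \sw_(a', h' <- q)
  \sw_(x1, x2, x3 <- qb_Phi' Q) \sw_(h1, h2 <- qb_Delta Q h)
    ((x1 · a) ∘ ((x2 * h1) · a')) ⊗ (x3 * h2 * h').

Lemma qb_Delta_linear : linear (qb_Delta Q).
Proof. by case: (qb_Delta_alg Q). Qed.

Lemma lin_Delta (T : lmodType K) (f : T -> H) :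
  linear f -> linear (fun t => qb_Delta Q (f t)).
Proof. exact: lin_comp qb_Delta_linear. Qed.

Lemma lin_actl (T : lmodType K) (f : T -> H) a :
  linear f -> linear (fun t => f t · a).
Proof. have [l _] := ma_act_bilinear M; exact: lin_comp (l a). Qed.
Lemma lin_actr (T : lmodType K) (f : T -> A) h :
  linear f -> linear (fun t => h · f t).
Proof. have [_ l] := ma_act_bilinear M; exact: lin_comp (l h). Qed.
Lemma lin_mmull (T : lmodType K) (f : T -> A) a :
  linear f -> linear (fun t => f t ∘ a).
Proof. have [l _] := ma_mul_bilinear M; exact: lin_comp (l a). Qed.
Lemma lin_mmulr (T : lmodType K) (f : T -> A) a :
  linear f -> linear (fun t => a ∘ f t).
Proof. have [_ l] := ma_mul_bilinear M; exact: lin_comp (l a). Qed.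

Lemma lin_tmap (V W V' W' T : lmodType K) (f : V -> V') (g : W -> W') (h : T -> V ⊗ W) :
  linear f -> linear g -> linear h -> linear (fun t => tmap f g (h t)).
Proof. by move=> fL gL; apply: (lin_comp (tmap_linear fL gL)). Qed.

Local Notation H2 := (H ⊗ H)%type.
Local Notation H3 := (H ⊗ (H ⊗ H))%type.
Local Notation H4 := (H ⊗ (H ⊗ (H ⊗ H)))%type.

Lemma lin_mulr2 (T : lmodType K) (c : H2) (f : T -> H2) :
  linear f -> linear (fun t => (c * f t : H2)).
Proof. exact: lin_mulr. Qed.
Lemma lin_mull2 (T : lmodType K) (c : H2) (f : T -> H2) :
  linear f -> linear (fun t => (f t * c : H2)).
Proof. exact: lin_mull. Qed.
Lemma lin_mulr3 (T : lmodType K) (c : H3) (f : T -> H3) :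
  linear f -> linear (fun t => (c * f t : H3)).
Proof. exact: lin_mulr. Qed.
Lemma lin_mull3 (T : lmodType K) (c : H3) (f : T -> H3) :
  linear f -> linear (fun t => (f t * c : H3)).
Proof. exact: lin_mull. Qed.
Lemma lin_mulr4 (T : lmodType K) (c : H4) (f : T -> H4) :
  linear f -> linear (fun t => (c * f t : H4)).
Proof. exact: lin_mulr. Qed.
Lemma lin_mull4 (T : lmodType K) (c : H4) (f : T -> H4) :
  linear f -> linear (fun t => (f t * c : H4)).
Proof. exact: lin_mull. Qed.

Ltac slin := repeat first
  [ assumption
  | match goal with |- bilinear_map _ => split; move=> ?; cbv beta end
  | match goal with |- forall _, _ => intro; cbv beta end
  | match goal with |- linear (fun x => x) => apply: lin_id end
  | match goal with |- @GRing.linear_for _ _ _ _ ?f =>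
      lazymatch f with (fun _ => _) => fail | _ => change f with (fun x => f x) end
    end
  | match goal with
    | |- linear (fun x => tens ?v _) => apply: (lin_tensr v)
    | |- linear (fun x => tens _ ?w) => apply: (lin_tensl w)
    | |- linear (fun x => ma_act _ ?h _) => apply: (lin_actr h)
    | |- linear (fun x => ma_act _ _ ?c) => apply: (lin_actl c)
    | |- linear (fun x => ma_mul _ ?c _) => apply: (lin_mmulr c)
    | |- linear (fun x => ma_mul _ _ ?c) => apply: (lin_mmull c)
    | |- linear (fun x => amul ?h _) => first [apply: (lin_mulr4 h) | apply: (lin_mulr3 h) | apply: (lin_mulr2 h) | apply: (lin_mulr h)]
    | |- linear (fun x => amul _ ?h) => first [apply: (lin_mull4 h) | apply: (lin_mull3 h) | apply: (lin_mull2 h) | apply: (lin_mull h)]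
    | |- linear (fun x => tassoc _) => apply: (lin_comp (@tassoc_linear _ _ _ _))
    | |- linear (fun x => tmap _ _ _) => apply: lin_tmap
    | |- linear (fun x => qb_Delta _ _) => apply: lin_Delta
    | |- linear (fun x => tlift ?y _) => apply: (lin_tlift_f y)
    | |- linear (fun x => tlift _ ?f) => apply: (lin_tlift_t (f := f))
    | |- linear (fun x => GRing.scale ?c _) => apply: (lin_scale c)
    | |- linear (fun x => GRing.scale _ ?v) => apply: (lin_scalel v)
    end ].

Lemma smash_mul_bilinear : bilinear_map smash_mul.
Proof. rewrite /smash_mul; slin. Qed.

Lemma smash_mulE a h a' h' :
  smash_mul (a ⊗ h) (a' ⊗ h') =
  \sw_(x1, x2, x3 <- qb_Phi' Q) \sw_(h1, h2 <- qb_Delta Q h)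
    ((x1 · a) ∘ ((x2 * h1) · a')) ⊗ (x3 * h2 * h').
Proof. rewrite /smash_mul !tliftE //; slin. Qed.



(* Unification is very slow on iterated tensor products if these unfold. *)
Local Opaque tmul tlift tens tmap tassoc tensor.

Lemma DM x y : qb_Delta Q (x * y) = qb_Delta Q x * qb_Delta Q y.
Proof. by case: (qb_Delta_alg Q). Qed.
Lemma D1 : qb_Delta Q 1 = 1. Proof. by case: (qb_Delta_alg Q). Qed.

Section Assoc.
Variables (a a' a'' : A) (h'' : H).

Definition F (t : H ⊗ (H ⊗ (H ⊗ H))) : A ⊗ H :=
  \sw_(t1, s <- t) \sw_(t2, r <- s) \sw_(t3, t4 <- r)
    ((t1 · a) ∘ ((t2 · a') ∘ (t3 · a''))) ⊗ (t4 * h'').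
Definition G (t : H ⊗ (H ⊗ (H ⊗ H))) : A ⊗ H :=
  \sw_(t1, s <- t) \sw_(t2, r <- s) \sw_(t3, t4 <- r)
    (((t1 · a) ∘ (t2 · a')) ∘ (t3 · a'')) ⊗ (t4 * h'').

Lemma FL : linear F. Proof. rewrite /F; slin. Qed.
Lemma GL : linear G. Proof. rewrite /G; slin. Qed.
Lemma FE t1 t2 t3 t4 : F (t1 ⊗ (t2 ⊗ (t3 ⊗ t4))) =
  ((t1 · a) ∘ ((t2 · a') ∘ (t3 · a''))) ⊗ (t4 * h'').
Proof. rewrite /F !tliftE //; slin. Qed.
Lemma GE t1 t2 t3 t4 : G (t1 ⊗ (t2 ⊗ (t3 ⊗ t4))) =
  (((t1 · a) ∘ (t2 · a')) ∘ (t3 · a'')) ⊗ (t4 * h'').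
Proof. rewrite /G !tliftE //; slin. Qed.
Lemma lin_F (T : lmodType K) (f : T -> H ⊗ (H ⊗ (H ⊗ H))) :
  linear f -> linear (fun t => F (f t)).
Proof. exact: lin_comp FL. Qed.
Lemma lin_G (T : lmodType K) (f : T -> H ⊗ (H ⊗ (H ⊗ H))) :
  linear f -> linear (fun t => G (f t)).
Proof. exact: lin_comp GL. Qed.

Ltac fgslin := repeat first
  [ progress slin
  | match goal with
    | |- linear (fun x => F _) => apply: lin_F
    | |- linear (fun x => G _) => apply: lin_G
    end ].

Definition p4 (P : H ⊗ (H ⊗ H)) := (id ⊠ @tassoc _ H H H) (tassoc (P ⊗ (1 : H))).

Lemma G_F X : G X = F (p4 (qb_Phi Q) * X).
Proof.
rewrite /p4; move: X; apply: lin_eq; [fgslin | fgslin | move=> t1]; apply: lin_eq; [fgslin | fgslin | move=> t2].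
apply: lin_eq; [fgslin | fgslin | move=> t3 t4]; rewrite GE ma_mulA.
rewrite (tlift_comp (g := fun u => u ⊗ (t4 * h''))); last by slin.
move: (qb_Phi Q); apply: lin_eq; [fgslin | fgslin | move=> x1]; apply: lin_eq; [fgslin | fgslin | move=> x2 x3].
rewrite !tliftE; fgslin.
rewrite !tassocE tmapE ?tassocE; fgslin.
by rewrite !tensM FE amul1 !ma_actM.
Qed.

Definition m4 (P : H3) : H4 := (id ⊠ @tassoc _ H H H) ((id ⊠ (qb_Delta Q ⊠ id)) P).
Definition l4 (P : H3) : H4 := (id ⊠ (id ⊠ qb_Delta Q)) P.
Definition r4 (P : H3) : H4 := tassoc ((qb_Delta Q ⊠ id) P).

Lemma lin_p4 (T : lmodType K) (f : T -> H3) : linear f -> linear (fun t => p4 (f t)).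
Proof. by move=> fL; rewrite /p4; slin. Qed.
Lemma lin_m4 (T : lmodType K) (f : T -> H3) : linear f -> linear (fun t => m4 (f t)).
Proof. by move=> fL; rewrite /m4; slin. Qed.
Lemma lin_l4 (T : lmodType K) (f : T -> H3) : linear f -> linear (fun t => l4 (f t)).
Proof. by move=> fL; rewrite /l4; slin. Qed.
Lemma lin_r4 (T : lmodType K) (f : T -> H3) : linear f -> linear (fun t => r4 (f t)).
Proof. by move=> fL; rewrite /r4; slin. Qed.

Ltac allslin := repeat first
  [ progress fgslin
  | match goal with
    | |- linear (fun x => p4 _) => apply: lin_p4
    | |- linear (fun x => m4 _) => apply: lin_m4
    | |- linear (fun x => l4 _) => apply: lin_l4
    | |- linear (fun x => r4 _) => apply: lin_r4
    end ].

Lemma l4E x1 x2 x3 : l4 (x1 ⊗ (x2 ⊗ x3)) = x1 ⊗ (x2 ⊗ qb_Delta Q x3).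
Proof. by rewrite /l4 !tmapE //; slin. Qed.
Lemma r4E x1 x2 x3 : r4 (x1 ⊗ (x2 ⊗ x3)) = tassoc (qb_Delta Q x1 ⊗ (x2 ⊗ x3)).
Proof. by rewrite /r4 tmapE //; slin. Qed.
Lemma m4E x1 x2 x3 :
  m4 (x1 ⊗ (x2 ⊗ x3)) = x1 ⊗ tassoc (qb_Delta Q x2 ⊗ x3).
Proof. by rewrite /m4 !tmapE //; slin. Qed.

Lemma smashL (Y X : H3) (D : H2) (h' : H) :
  (\sw_(x1, x2, x3 <- X) \sw_(h1, h2 <- D)
   \sw_(y1, y2, y3 <- Y) \sw_(e1, e2 <- qb_Delta Q (x3 * h2 * h'))
    ((y1 · ((x1 · a) ∘ ((x2 * h1) · a'))) ∘ ((y2 * e1) · a'')) ⊗ (y3 * e2 * h''))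
  = G (r4 Y * (l4 X * (((1 : H) ⊗ (id ⊠ qb_Delta Q) D)
         * ((1 : H) ⊗ ((1 : H) ⊗ qb_Delta Q h'))))).
Proof.
move: X; apply: lin_eq; [allslin | allslin | move=> x1].
apply: lin_eq; [allslin | allslin | move=> x2 x3].
move: D; apply: lin_eq; [allslin | allslin | move=> d1 d2].
move: Y; apply: lin_eq; [allslin | allslin | move=> y1].
apply: lin_eq; [allslin | allslin | move=> y2 y3].
rewrite !tliftE; try by allslin.
rewrite r4E l4E tmapE; try by slin.
rewrite !tensM amul1 !amulr1 !DM -!amulA.
move: (qb_Delta Q x3 * _) => E.
rewrite ma_act_mul.
move: (qb_Delta Q y1) => P.
under eq_tlift => e1 e2 do
  (rewrite (tlift_comp (g := fun u => (u ∘ ((y2 * e1) · a'')) ⊗ (y3 * e2 * h''))); last by slin).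
move: P; apply: lin_eq; [allslin | allslin | move=> p1 p2].
move: E; apply: lin_eq; [allslin | allslin | move=> e1 e2].
rewrite !tliftE; try by allslin.
by rewrite tassocE !tensM GE !ma_actM ?amulA.
Qed.

Lemma smashR (Y X : H3) (D E : H2) :
  (\sw_(y1, y2, y3 <- Y) \sw_(e1, e2 <- E)
   \sw_(x1, x2, x3 <- X) \sw_(h1, h2 <- D)
    ((x1 · a) ∘ ((x2 * h1) · ((y1 · a') ∘ ((y2 * e1) · a''))))
      ⊗ (x3 * h2 * (y3 * e2 * h'')))
  = F (m4 X * (((1 : H) ⊗ tassoc ((qb_Delta Q ⊠ id) D)) * (((1 : H) ⊗ Y)
         * ((1 : H) ⊗ ((1 : H) ⊗ E))))).
Proof.
move: X; apply: lin_eq; [allslin | allslin | move=> x1].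
apply: lin_eq; [allslin | allslin | move=> x2 x3].
move: D; apply: lin_eq; [allslin | allslin | move=> d1 d2].
move: Y; apply: lin_eq; [allslin | allslin | move=> y1].
apply: lin_eq; [allslin | allslin | move=> y2 y3].
move: E; apply: lin_eq; [allslin | allslin | move=> e1 e2].
rewrite !tliftE; try by allslin.
rewrite m4E tmapE; try by slin.
rewrite !tensM !amul1 !amulr1.
have [_ _ aM] := @tassoc_alg_map K H H H.
rewrite [tassoc _ * (tassoc _ * _)]amulA -aM tensM -DM ma_act_mul.
rewrite (tlift_comp (g := fun u => ((x1 · a) ∘ u) ⊗ (x3 * d2 * (y3 * e2 * h'')))); last by slin.
move: (qb_Delta Q _); apply: lin_eq; [allslin | allslin | move=> p1 p2].
rewrite !tliftE; try by allslin.
by rewrite tassocE !tensM FE !ma_actM ?amulA.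
Qed.

End Assoc.

Lemma tensl_alg_map (U V : assocAlgType K) : alg_map (fun u : U => u ⊗ (1 : V)).
Proof. by split=> // [|x y]; [apply: lin_tensl | rewrite tensM amul1]. Qed.

Lemma p4_alg_map : alg_map p4.
Proof.
apply: comp_alg_map (tmap_alg_map (id_alg_map _) (tassoc_alg_map _ _ _)) _.
exact: comp_alg_map (tassoc_alg_map _ _ _) (tensl_alg_map _ _).
Qed.
Lemma l4_alg_map : alg_map l4.
Proof.
apply: (tmap_alg_map (id_alg_map _)).
exact: tmap_alg_map (id_alg_map _) (qb_Delta_alg Q).
Qed.
Lemma r4_alg_map : alg_map r4.
Proof.
apply: comp_alg_map (tassoc_alg_map _ _ _) _.
exact: tmap_alg_map (qb_Delta_alg Q) (id_alg_map _).
Qed.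
Lemma m4_alg_map : alg_map m4.
Proof.
apply: comp_alg_map (tmap_alg_map (id_alg_map _) (tassoc_alg_map _ _ _)) _.
apply: (tmap_alg_map (id_alg_map _)).
exact: tmap_alg_map (qb_Delta_alg Q) (id_alg_map _).
Qed.

Lemma alg_mapV (X Y : assocAlgType K) (f : X -> Y) x y :
  alg_map f -> x * y = 1 -> f x * f y = 1.
Proof. by case=> _ f1 fM xy; rewrite -fM xy f1. Qed.

Lemma pentagonV_abstract (X : assocAlgType K) (m' m p l' l r' r q' q : X) :
  q' * m * p = l' * r' -> q * q' = 1 -> m' * m = 1 -> l' * l = 1 ->
  r' * r = 1 -> p * (r * l) = m' * q.
Proof.
move=> pent q1 m1 l1 r1; have -> : p = m' * q * (l' * r').
  by rewrite -pent !amulA -(amulA m' q q') q1 amulr1 m1 amul1.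
by rewrite !amulA -(amulA _ r' r) r1 amulr1 -(amulA _ l' l) l1 amulr1.
Qed.

Lemma pentagonV :
  p4 (qb_Phi Q) * (r4 (qb_Phi' Q) * l4 (qb_Phi' Q))
  = m4 (qb_Phi' Q) * ((1 : H) ⊗ qb_Phi' Q).
Proof.
have pent : ((1 : H) ⊗ qb_Phi Q) * m4 (qb_Phi Q) * p4 (qb_Phi Q)
    = l4 (qb_Phi Q) * r4 (qb_Phi Q) by exact: qb_pentagon.
have q1 := alg_mapV (tensr_alg_map H _) (qb_PhiK Q).
have m1 := alg_mapV m4_alg_map (qb_PhiK Q).
have l1 := alg_mapV l4_alg_map (qb_PhiVK Q).
have r1 := alg_mapV r4_alg_map (qb_PhiVK Q).
exact: pentagonV_abstract pent q1 m1 l1 r1.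
Qed.

Lemma coassocV h :
  qb_Phi' Q * (id ⊠ qb_Delta Q) (qb_Delta Q h)
  = tassoc ((qb_Delta Q ⊠ id) (qb_Delta Q h)) * qb_Phi' Q.
Proof. by rewrite qb_coassoc !amulA qb_PhiK amul1. Qed.

Lemma smash_mulA_abstract (X : assocAlgType K) (p r l m q c c2 e : X) :
  p * (r * l) = m * q -> q * c = c2 * q ->
  p * (r * (l * (c * e))) = m * (c2 * (q * e)).
Proof.
by move=> E1 E2; rewrite !amulA -(amulA p) E1 -(amulA m) E2 !amulA.
Qed.

Lemma smash_mulA : associative smash_mul.
Proof.
have [mL mR] := smash_mul_bilinear.
move=> x y z; move: x; apply: lin_eq.
- exact: mL.
- exact: lin_comp (mL z) (mL y).
move=> a h; move: y; apply: lin_eq.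
- exact: lin_comp (mR _) (mL z).
- exact: lin_comp (mL z) (mR _).
move=> a' h'; move: z; apply: lin_eq.
- exact: lin_comp (mR _) (mR _).
- exact: mR.
move=> a'' h''.
transitivity (\sw_(y1, y2, y3 <- qb_Phi' Q) \sw_(e1, e2 <- qb_Delta Q h')
   \sw_(x1, x2, x3 <- qb_Phi' Q) \sw_(h1, h2 <- qb_Delta Q h)
    ((x1 · a) ∘ ((x2 * h1) · ((y1 · a') ∘ ((y2 * e1) · a''))))
      ⊗ (x3 * h2 * (y3 * e2 * h''))).
  rewrite (smash_mulE a' h').
  do 3![rewrite (tlift_comp _ _ (mR (a ⊗ h))); apply: eq_tlift => ? ?].
  by rewrite smash_mulE.
transitivity (\sw_(x1, x2, x3 <- qb_Phi' Q) \sw_(h1, h2 <- qb_Delta Q h)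
   \sw_(y1, y2, y3 <- qb_Phi' Q) \sw_(e1, e2 <- qb_Delta Q (x3 * h2 * h'))
    ((y1 · ((x1 · a) ∘ ((x2 * h1) · a'))) ∘ ((y2 * e1) · a''))
      ⊗ (y3 * e2 * h'')); last first.
  apply: esym; rewrite (smash_mulE a h).
  do 3![rewrite (tlift_comp (g := smash_mul^~ (a'' ⊗ h'')) _ _ (mL _)) /=;
        apply: eq_tlift => ? ?].
  by rewrite smash_mulE.
rewrite smashL smashR G_F; congr F.
have [_ _ tM] := tensr_alg_map H (H ⊗ (H ⊗ H))%type.
have key := congr1 (fun t : H3 => (1 : H) ⊗ t) (coassocV h); rewrite !tM in key.
exact/esym/(smash_mulA_abstract _ pentagonV key).
Qed.

Lemma alg_map1V (X Y : assocAlgType K) (f : X -> Y) x y :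
  alg_map f -> x * y = 1 -> f x = 1 -> f y = 1.
Proof. by move=> fA /(alg_mapV fA) fxy fx; rewrite fx amul1 in fxy. Qed.

Lemma eps_Phi'1 : (\sw_(x1, x2, x3 <- qb_Phi' Q) qb_eps Q x1 *: (x2 ⊗ x3)) = 1.
Proof.
have eL := qb_eps_linear Q.
pose f (x : H3) : H2 := \sw_(x1, x2, x3 <- x) qb_eps Q x1 *: (x2 ⊗ x3).
have fL : linear f by rewrite /f; slin.
have fE x1 s : f (x1 ⊗ s) = qb_eps Q x1 *: s.
  move: s; apply: lin_eq; [exact: lin_comp fL (lin_tensr _ (@lin_id _ _)) | | ].
    by slin.
  by move=> x2 x3; rewrite /f !tliftE //; slin.
apply: (alg_map1V (f := f) _ (qb_PhiVK Q) (qb_eps_Phi1 Q)).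
apply: tens_alg_map => //; first by rewrite tens1 fE qb_eps1 scale1r.
move=> v v' w w'; rewrite tensM !fE qb_epsM.
rewrite (linZ (proj1 (@amul_bilinear K H2) _)).
by rewrite (linZ (proj2 (@amul_bilinear K H2) _)) scalerA.
Qed.

Lemma eps_Phi'2 : (\sw_(x1, x2, x3 <- qb_Phi' Q) qb_eps Q x2 *: (x1 ⊗ x3)) = 1.
Proof.
have eL := qb_eps_linear Q.
pose g (s : H2) : H := \sw_(x2, x3 <- s) qb_eps Q x2 *: x3.
have gL : linear g by rewrite /g; slin.
have gE x2 x3 : g (x2 ⊗ x3) = qb_eps Q x2 *: x3.
  by rewrite /g tliftE //; slin.
have gA : alg_map g.
  apply: tens_alg_map => //; first by rewrite tens1 gE qb_eps1 scale1r.
  move=> v v' w w'; rewrite tensM !gE qb_epsM.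
  rewrite (linZ (proj1 (@amul_bilinear K H) _)).
  by rewrite (linZ (proj2 (@amul_bilinear K H) _)) scalerA.
have fE x : (\sw_(x1, x2, x3 <- x) qb_eps Q x2 *: (x1 ⊗ x3)) = (id ⊠ g) x.
  move: x; apply: lin_eq; [by slin | by slin | move=> x1].
  apply: lin_eq; [by slin | by slin | move=> x2 x3].
  rewrite tmapE // gE !tliftE; try by slin.
  by rewrite tensZr.
rewrite fE; apply: (alg_map1V (tmap_alg_map (id_alg_map H) gA) (qb_PhiVK Q)).
by rewrite -fE qb_eps_Phi2.
Qed.

Lemma smash_mul1 : left_id smash_one smash_mul.
Proof.
have [mL mR] := smash_mul_bilinear.
apply: lin_eq; [exact: mR | exact: lin_id | move=> a h].
rewrite smash_mulE D1.
transitivity (\sw_(x2, x3 <- \sw_(x1, x2, x3 <- qb_Phi' Q) qb_eps Q x1 *: (x2 ⊗ x3))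
   (x2 · a) ⊗ (x3 * h)); last first.
  by rewrite eps_Phi'1 tliftE ?ma_act1 ?amul1 //; slin.
have kL : linear (fun t : H2 => \sw_(x2, x3 <- t) (x2 · a) ⊗ (x3 * h)) by slin.
rewrite (tlift_comp _ _ kL); apply: eq_tlift => x1 s.
rewrite (tlift_comp _ _ kL); apply: eq_tlift => x2 x3.
rewrite (linZ kL) !tliftE; try by slin.
by rewrite !amulr1 ma_act_one (linZ (proj1 (ma_mul_bilinear M) _)) ma_mul1 tensZl.
Qed.

Lemma smash_mulr1 : right_id smash_one smash_mul.
Proof.
have [mL mR] := smash_mul_bilinear.
apply: lin_eq; [exact: mL | exact: lin_id | move=> a h].
rewrite smash_mulE.
have kL : linear (fun t : H2 => \sw_(x1, x3 <- t) \sw_(h1, h2 <- qb_Delta Q h)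
   qb_eps Q h1 *: ((x1 · a) ⊗ (x3 * h2))) by slin.
transitivity (\sw_(x1, x3 <- \sw_(x1, x2, x3 <- qb_Phi' Q) qb_eps Q x2 *: (x1 ⊗ x3))
   \sw_(h1, h2 <- qb_Delta Q h) qb_eps Q h1 *: ((x1 · a) ⊗ (x3 * h2))).
  rewrite (tlift_comp _ _ kL); apply: eq_tlift => x1 s.
  rewrite (tlift_comp _ _ kL); apply: eq_tlift => x2 x3.
  rewrite (linZ kL) tliftE; last by slin; apply: qb_eps_linear.
  rewrite (tlift_comp (g := *:%R (qb_eps Q x2))); last by slin.
  apply: eq_tlift => h1 h2.
  rewrite amulr1 ma_act_one qb_epsM -scalerA.
  by rewrite !(linZ (proj2 (ma_mul_bilinear M) _)) ma_mulr1 !tensZl.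
rewrite eps_Phi'2 tliftE; last by slin; apply: qb_eps_linear.
rewrite ma_act1 -[in RHS](qb_counitl Q h).
rewrite (tlift_comp (g := tens a)); last by slin.
by apply: eq_tlift => h1 h2; rewrite amul1 tensZr.
Qed.

End Smash.

Definition smash (K : fieldType) (H : assocAlgType K) (Q : quasiBialgebra H)
  (A : lmodType K) (M : moduleAlgebra Q A) : Type := (A ⊗ H)%type.

Section SmashAlgebra.
Variables (K : fieldType) (H : assocAlgType K) (Q : quasiBialgebra H).
Variables (A : lmodType K) (M : moduleAlgebra Q A).

HB.instance Definition _ := GRing.Lmodule.copy (smash M) (A ⊗ H)%type.
HB.instance Definition _ := Lmodule_isAssocAlgebra.Build K (smash M)
  (smash_mulA M) (smash_mul1 M) (smash_mulr1 M) (smash_mul_bilinear M).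

Definition smash_mk (a : A) (h : H) : smash M := a ⊗ h.
Definition smash_i (a : A) : smash M := smash_mk a 1.
Definition smash_j (h : H) : smash M := smash_mk (ma_one M) h.

End SmashAlgebra.

(* Main.v *)
(** The map [w (a # h) = v a * gamma h] is multiplicative because
    [v ((t1 . a) (t2 . a')) * gamma t3] is the value at [Phi * (t1 ⊗ t2 ⊗ t3)]
    of [X ↦ v (X1 . a) * v (X2 . a') * gamma X3]: the factor [Phi] coming from
    the multiplication rule for [v] cancels the factor [Phi^-1] in the
    multiplication of the smash product, and what is left is the commutation
    rule between [gamma] and [v]. Uniqueness holds because
    [a # h = i a * j h]. *)

Require Import Defs.
From mathcomp Require Import all_boot all_algebra.
From mathcomp Require Import boolp.

Set Implicit Arguments.
Unset Strict Implicit.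
Unset Printing Implicit Defensive.

Import GRing.Theory.
Local Open Scope ring_scope.
Local Open Scope assoc_scope.

Section SmashGenerators.
Variables (K : fieldType) (H : assocAlgType K) (Q : quasiBialgebra H).
Variables (A : lmodType K) (M : moduleAlgebra Q A).

Local Opaque tmul tlift tens tmap tassoc tensor.

(** The [H]-component of the right operand enters the smash product only as the rightmost factor in
    [H], so associativity of [H] lets [h] be pulled out. *)
Lemma smash_mul_tmapr (p : A ⊗ H) (a : A) (g h : H) :
  smash_mul M p (a ⊗ (g * h))
  = (id ⊠ (fun x : H => x * h)) (smash_mul M p (a ⊗ g)).
Proof.
have [mL _] := smash_mul_bilinear M.
have RL : linear (id ⊠ (fun x : H => x * h) : A ⊗ H -> A ⊗ H).
  by apply: tmap_linear => //; apply: lin_mull.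
move: p; apply: lin_eq; [exact: mL | exact: lin_comp RL (mL _) | move=> b k].
rewrite !smash_mulE; do 3![rewrite (tlift_comp _ _ RL); apply: eq_tlift => ? ?].
by rewrite tmapE ?amulA //; apply: lin_mull.
Qed.

Lemma smash_mk_ij (a : A) (h : H) : smash_mk M a h = smash_i M a * smash_j M h.
Proof.
change (a ⊗ h = smash_mul M (a ⊗ 1) (ma_one M ⊗ h)).
(* Writing [h] as [1 * h] and pulling [h] out leaves [(a # 1)(1_A # 1)], settled by the right unit
   law without expanding [Phi^-1] or [Delta]. *)
rewrite -(amul1 h) smash_mul_tmapr smash_mulr1 tmapE //; exact: lin_mull.
Qed.

End SmashGenerators.

Section SmashUniversal.
Variables (K : fieldType) (H : assocAlgType K) (Q : quasiBialgebra H).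
Variables (A : lmodType K) (M : moduleAlgebra Q A) (B : assocAlgType K).
Variables (gamma : H -> B) (v : A -> B).
Hypotheses (gamma_alg : alg_map gamma) (v_lin : linear v).
Hypothesis gamma_v : forall h a,
  gamma h * v a = \sw_(h1, h2 <- qb_Delta Q h) v (ma_act M h1 a) * gamma h2.
Hypothesis v_mul : forall a a',
  v (ma_mul M a a') = \sw_(x1, x2, x3 <- qb_Phi Q)
    v (ma_act M x1 a) * v (ma_act M x2 a') * gamma x3.
Hypothesis v_one : v (ma_one M) = 1.

Local Opaque tmul tlift tens tmap tassoc tensor.

Let gamma_lin : linear gamma. Proof. by case: gamma_alg. Qed.
Let gamma1 : gamma 1 = 1. Proof. by case: gamma_alg. Qed.
Let gammaM x y : gamma (x * y) = gamma x * gamma y.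
Proof. by case: gamma_alg. Qed.

Let lin_gamma (T : lmodType K) (f : T -> H) :
  linear f -> linear (fun t => gamma (f t)).
Proof. exact: lin_comp gamma_lin. Qed.
Let lin_v (T : lmodType K) (f : T -> A) :
  linear f -> linear (fun t => v (f t)).
Proof. exact: lin_comp v_lin. Qed.

Ltac slin := repeat first
  [ assumption
  | match goal with |- bilinear_map _ => split; move=> ?; cbv beta end
  | match goal with |- forall _, _ => intro; cbv beta end
  | match goal with |- linear (fun x => x) => apply: lin_id end
  | match goal with |- @GRing.linear_for _ _ _ _ ?f =>
      lazymatch f with (fun _ => _) => fail | _ => change f with (fun x => f x) end
    end
  | match goal with
    | |- linear (fun x => gamma _) => apply: lin_gamma
    | |- linear (fun x => v _) => apply: lin_v
    | |- linear (fun x => tens ?v _) => apply: (lin_tensr v)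
    | |- linear (fun x => tens _ ?w) => apply: (lin_tensl w)
    | |- linear (fun x => ma_act _ ?h _) => apply: (lin_actr _ h)
    | |- linear (fun x => ma_act _ _ ?c) => apply: (lin_actl _ c)
    | |- linear (fun x => ma_mul _ ?c _) => apply: (lin_mmulr _ c)
    | |- linear (fun x => ma_mul _ _ ?c) => apply: (lin_mmull _ c)
    | |- linear (fun x => @amul _ (tensor H (tensor H H)) ?h _) => apply: (lin_mulr3 h)
    | |- linear (fun x => amul ?h _) => apply: (lin_mulr h)
    | |- linear (fun x => amul _ ?h) => apply: (lin_mull h)
    | |- linear (fun x => tlift ?y _) => apply: (lin_tlift_f y)
    | |- linear (fun x => tlift _ ?f) => apply: (lin_tlift_t (f := f))
    end ].

Definition smash_lift (p : smash M) : B := \sw_(a, h <- p) v a * gamma h.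

Lemma smash_lift_linear : linear smash_lift.
Proof. by apply: tlift_linear; slin. Qed.

Lemma smash_liftE a h : smash_lift (a ⊗ h) = v a * gamma h.
Proof. by rewrite /smash_lift tliftE //; slin. Qed.

(** The elements [t1] and [t2] are absorbed into the legs of [Phi] by the module law, and [t3] by
    multiplicativity of [gamma]. *)
Lemma v_act_mul_gamma a a' (t1 t2 t3 : H) :
  v (ma_mul M (ma_act M t1 a) (ma_act M t2 a')) * gamma t3
  = \sw_(x1, x2, x3 <- qb_Phi Q * (t1 ⊗ (t2 ⊗ t3)))
      v (ma_act M x1 a) * v (ma_act M x2 a') * gamma x3.
Proof.
rewrite v_mul; move: (qb_Phi Q).
(* Both sides are linear in [Phi], now replaced by an arbitrary tensor, so pure tensors suffice. *)
apply: lin_eq; [slin | slin | move=> x1].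
apply: lin_eq; [slin | slin | move=> x2 x3].
rewrite !tensM !tliftE; try by slin.
by rewrite !ma_actM gammaM !amulA.
Qed.

Lemma smash_lift_mul a h a' h' :
  smash_lift (smash_mul M (a ⊗ h) (a' ⊗ h'))
  = v a * gamma h * (v a' * gamma h').
Proof.
have wL : linear (smash_lift : A ⊗ H -> B) := smash_lift_linear.
pose E (t : H ⊗ (H ⊗ H)) :=
  \sw_(x1, x2, x3 <- t) v (ma_act M x1 a) * v (ma_act M x2 a') * gamma x3.
have EL : linear E by rewrite /E; slin.
have lin_E (T : lmodType K) (f : T -> H ⊗ (H ⊗ H)) :
  linear f -> linear (fun t => E (f t)) by exact: lin_comp EL.
(* [Phi^-1] and [Delta h] are generalised to independent tensors [X] and [D], which linearity
   reduces to pure ones; the [Phi] produced by [v_mul] stays fixed. *)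
have cancel (X : H ⊗ (H ⊗ H)) (D : H ⊗ H) :
  smash_lift (\sw_(x1, x2, x3 <- X) \sw_(h1, h2 <- D)
    (ma_mul M (ma_act M x1 a) (ma_act M (x2 * h1) a') ⊗ (x3 * h2 * h')))
  = E (qb_Phi Q * (X * ((1 : H) ⊗ D))) * gamma h'.
  move: X; apply: lin_eq; [by apply: (lin_comp wL); slin | | move=> x1].
    by apply: lin_mull; apply: lin_E; apply: lin_mulr3; apply: lin_mull3; slin.
  apply: lin_eq; [by apply: (lin_comp wL); slin | | move=> x2 x3].
    by apply: lin_mull; apply: lin_E; apply: lin_mulr3; apply: lin_mull3; slin.
  move: D; apply: lin_eq; [by apply: (lin_comp wL); slin | | move=> h1 h2].
    by apply: lin_mull; apply: lin_E; apply: lin_mulr3; apply: lin_mulr3; slin.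
  rewrite !tliftE; try by slin.
  by rewrite smash_liftE gammaM amulA v_act_mul_gamma !tensM amulr1.
(* At [X = Phi^-1] the two associators cancel, leaving [E (1 ⊗ Delta h) * gamma h']. *)
rewrite smash_mulE cancel amulA qb_PhiVK amul1 -!amulA.
(* On the other side [gamma h * v a'] is isolated in the middle, where the commutation rule also
   produces a sum over [Delta h]. *)
rewrite [gamma h * _]amulA gamma_v amulA.
congr (_ * _); move: (qb_Delta Q h).
apply: lin_eq; [by apply: lin_E; slin | slin | move=> h1 h2].
rewrite /E !tliftE; try by slin.
by rewrite ma_act1 amulA.
Qed.

Lemma smash_lift_alg_map : alg_map smash_lift.
Proof.
have wL : linear (smash_lift : A ⊗ H -> B) := smash_lift_linear.
have [mL mR] := smash_mul_bilinear M.
split; [exact: wL | | ].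
  by rewrite [LHS]smash_liftE v_one gamma1 amul1.
move=> p q.
(* Unfolding the product of [smash M] exposes the carrier [A ⊗ H]; bilinearity in [p] and [q] then
   reduces the claim to pure tensors. *)
change (smash_lift (smash_mul M p q) = smash_lift p * smash_lift q).
move: p; apply: lin_eq; [exact: lin_comp wL (mL _) | exact: lin_mull wL | ].
move=> a h; move: q; apply: lin_eq.
- exact: lin_comp wL (mR _).
- exact: lin_mulr wL.
move=> a' h'.
by rewrite smash_lift_mul !smash_liftE.
Qed.

Lemma smash_lift_i : smash_lift \o smash_i M = v.
Proof. by apply/funext => a; rewrite /= smash_liftE gamma1 amulr1. Qed.

Lemma smash_lift_j : smash_lift \o smash_j M = gamma.
Proof. by apply/funext => h; rewrite /= smash_liftE v_one amul1. Qed.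

(** The values are forced because each [a # h] is a product of an element of the image of [i] and
    one of the image of [j]. *)
Lemma smash_alg_mapE (w : smash M -> B) :
  [/\ alg_map w, w \o smash_i M = v & w \o smash_j M = gamma] ->
  forall a h, w (smash_mk M a h) = v a * gamma h.
Proof. by move=> [[_ _ wM] <- <-] a h; rewrite smash_mk_ij wM. Qed.

(** Two linear maps that agree on the elements [a # h] are equal, since these span [A ⊗ H]. *)
Lemma smash_lift_unique (w : smash M -> B) :
  [/\ alg_map w, w \o smash_i M = v & w \o smash_j M = gamma] -> smash_lift = w.
Proof.
move=> wP; have [[wL _ _] _ _] := wP; apply/funext.
apply: (@lin_eq K A H); [exact: smash_lift_linear | exact: wL | move=> a h].
by rewrite smash_liftE -(smash_alg_mapE wP).
Qed.

End SmashUniversal.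

Theorem proposition7p4 (K : fieldType) (H : assocAlgType K)
  (Q : quasiHopfAlgebra H) (A : lmodType K) (M : moduleAlgebra Q A)
  (B : assocAlgType K) (gamma : H -> B) (v : A -> B)
  (gamma_alg : alg_map gamma) (v_lin : linear v)
  (gamma_v : forall (h : H) (a : A),
     gamma h * v a
     = \sw_(h1, h2 <- qb_Delta Q h) v (ma_act M h1 a) * gamma h2)
  (v_mul : forall a a' : A,
     v (ma_mul M a a')
     = \sw_(x1, x2, x3 <- qb_Phi Q)
         v (ma_act M x1 a) * v (ma_act M x2 a') * gamma x3)
  (v_one : v (ma_one M) = 1) :
  (exists! w : smash M -> B,
     [/\ alg_map w, w \o smash_i M = v & w \o smash_j M = gamma])
  /\ (forall w : smash M -> B,
     [/\ alg_map w, w \o smash_i M = v & w \o smash_j M = gamma] ->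
     forall (a : A) (h : H), w (smash_mk M a h) = v a * gamma h).
Proof.
split; last exact: smash_alg_mapE.
exists (smash_lift (M := M) gamma v); split; last exact: smash_lift_unique.
split; first exact: smash_lift_alg_map.
- exact: smash_lift_i.
- exact: smash_lift_j.
Qed.
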